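(* Let $X$ be a compact metric space. If $X$ satisfies axioms $A_1$, $A_2$, $A_3$, $A_4$ and $A_6'$ (listed in the context), then $X$ is homeomorphic to a straight hairy Cantor set.
   Context: Axioms for a metric space $X$: ($A_1$) any connected component of $X$ is either a single point or a Jordan arc (a homeomorphic image of $[0,1]$); ($A_2$) the closure of the set of point components of $X$ is a Cantor set, denoted $B$; ($A_3$) any arc component of $X$ meets $B$ at exactly one point, which is one of its two end points; ($A_4$) whenever $x_i\to x$ within $X$, the unique arc in $X$ connecting $x_i$ to $B$ converges to the unique arc in $X$ connecting $x$ to $B$, with convergence in the Hausdorff topology (for a point $z\in B$, the arc connecting $z$ to $B$ is the degenerate arc $\{z\}$); ($A_6'$) the set of the end points of the arc components of $X$ is dense in $X$. A set in $\mathbb{R}^2$ is called a straight hairy Cantor set if there are a Cantor set $C\subset\mathbb{R}$ and a function $l:C\to[0,+\infty)$ such that the set equals $\{(x,y)\in\mathbb{R}^2\mid x\in C,\ 0\le y\le l(x)\}$ and: (i) the set of $x\in C$ with $l(x)>0$ is dense in $C$; (ii) if $x\in C$ is an end point of $C$, then $l(x)=0=\limsup_{t\to x,\,t\in C}l(t)$; (iii) if $x\in C$ is not an end point of $C$, then $\limsup_{t\to x^-,\,t\in C}l(t)=\limsup_{t\to x^+,\,t\in C}l(t)=l(x)$. Here $x\in C$ is an end point of $C$ if there is $\delta>0$ such that $(x,x+\delta)\cap C=\emptyset$ or $(x-\delta,x)\cap C=\emptyset$. *)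

(* Defs.v *)
From HB Require Import structures.
From mathcomp Require Import all_boot all_order all_algebra.
From mathcomp Require Import all_classical all_reals all_analysis.

Set Implicit Arguments.
Unset Strict Implicit.
Unset Printing Implicit Defensive.

Import Order.TTheory GRing.Theory Num.Theory.
Import numFieldNormedType.Exports.

Local Open Scope classical_set_scope.
Local Open Scope ring_scope.

(* Only the values of f on A matter: f restricts to a homeomorphism from A
   onto B for the subspace topologies. *)
Definition homeomorphism_on {T U : topologicalType} (A : set T) (B : set U)
    (f : T -> U) : Prop :=
  [/\ set_bij A B f, {within A, continuous f} &
      exists2 g : U -> T, {within B, continuous g} & {in A, cancel f g}].

Definition homeomorphic {T U : topologicalType} (A : set T) (B : set U) : Prop :=
  exists f : T -> U, homeomorphism_on A B f.

Definition cantor_set {T : topologicalType} (A : set T) : Prop :=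
  homeomorphic [set: cantor_space] A.

Section HairyAxioms.
Context {R : realType} {X : metricType R}.

Definition jordan_arc (K : set X) : Prop :=
  homeomorphic (`[0, 1]%classic : set R) K.

Definition arc_joins (K : set X) (x y : X) : Prop :=
  exists2 g : R -> X, homeomorphism_on (`[0, 1]%classic : set R) K g &
    g 0 = x /\ g 1 = y.

Definition arc_end_point (K : set X) (e : X) : Prop :=
  exists y, arc_joins K e y.

Definition component (K : set X) : Prop :=
  exists x, K = connected_component [set: X] x.

Definition arc_component (K : set X) : Prop := component K /\ jordan_arc K.

Definition hausdorff_close (A B : set X) (e : R) : Prop :=
  [/\ 0 < e, A `<=` \bigcup_(b in B) ball b e &
             B `<=` \bigcup_(a in A) ball a e].

Definition hausdorff_dist (A B : set X) : \bar R :=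
  ereal_inf [set e%:E | e in hausdorff_close A B].

End HairyAxioms.

Section HairyAxiomsSpace.
Context {R : realType} (X : metricType R).

Definition hairy_base : set X :=
  closure [set x | component [set x]].

(* Under A1 and A3 each x has exactly one such K; the degenerate arc {x}
   is the one chosen when x lies in the base. *)
Definition arc_to_base (x : X) (K : set X) : Prop :=
  (hairy_base x /\ K = [set x]) \/
  (~ hairy_base x /\ exists2 b, hairy_base b & arc_joins K x b).

Definition axiom_A1 : Prop :=
  forall K : set X, component K -> (exists x, K = [set x]) \/ jordan_arc K.

Definition axiom_A2 : Prop := cantor_set hairy_base.

Definition axiom_A3 : Prop :=
  forall K : set X, arc_component K ->
    exists2 b, K `&` hairy_base = [set b] & arc_end_point K b.

Definition axiom_A4 : Prop :=
  forall (x_ : nat -> X) (x : X) (K_ : nat -> set X) (K : set X),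
    x_ n @[n --> \oo] --> x ->
    (forall n, arc_to_base (x_ n) (K_ n)) -> arc_to_base x K ->
    hausdorff_dist (K_ n) K @[n --> \oo] --> 0%E.

Definition axiom_A6' : Prop :=
  dense [set e : X | exists2 K, arc_component K & arc_end_point K e].

End HairyAxiomsSpace.

Section StraightHairyCantorSet.
Context {R : realType}.

Definition cantor_end_point (C : set R) (x : R) : Prop :=
  C x /\ exists2 d : R, 0 < d &
    `]x, x + d[%classic `&` C = set0 \/ `]x - d, x[%classic `&` C = set0.

(* Limits superior over t -> x exclude t = x and are taken in \bar R; l is
   only meaningful on C. *)
Definition straight_hairy_cantor_set (H : set (R * R)) : Prop :=
  exists (C : set R) (l : R -> R),
    [/\ cantor_set C, (forall x, C x -> 0 <= l x) &
        H = [set p | C p.1 /\ 0 <= p.2 <= l p.1]] /\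
    [/\ C `<=` closure [set x | C x /\ 0 < l x],
        (forall x, cantor_end_point C x ->
           l x = 0 /\
           limf_esup (fun t => (l t)%:E) (within C x^') = 0%E) &
        (forall x, C x -> ~ cantor_end_point C x ->
           limf_esup (fun t => (l t)%:E) (within C x^'-) = (l x)%:E /\
           limf_esup (fun t => (l t)%:E) (within C x^'+) = (l x)%:E)].

End StraightHairyCantorSet.

(* Main.v *)
Require Import Defs.
From mathcomp Require Import all_boot all_order all_algebra.
From mathcomp Require Import all_classical all_reals all_analysis.
From mathcomp Require Import lra zify.

Set Implicit Arguments.
Unset Strict Implicit.
Unset Printing Implicit Defensive.

Import Order.TTheory GRing.Theory Num.Theory.
Import numFieldNormedType.Exports.
Local Open Scope classical_set_scope.
Local Open Scope ring_scope.

(** The components of [X] are points and arcs (hairs) growing from the Cantor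
    set [B], the base.  Sending a point to the foot of its hair gives a
    retraction of [X] onto [B], continuous by [axiom_A4].  A height that vanishes
    on [B], is continuous, and is strictly increasing along every hair turns [X]
    into a subset of [B * R]: the fiber over [b] becomes [[0, l b]], where [l b]
    is the height of the tip.  Such a height is a Whitney function, i.e. a
    continuous, strictly monotone size of the arc from a point to its foot: for
    a dense sequence [q_n], sum with weights [2^-n] how much closer to [q_n] the
    whole arc comes than the foot alone does ([height], [height_continuous],
    [height_injective]).

    By compactness [l] is upper semicontinuous, and [axiom_A6'] makes tips dense,
    so near every point of [B] the function [l] takes, up to any error, all
    values between [0] and its value there ([straight_hairy_of_coordinates]).
    It remains to embed [B], seen as the Cantor space, in [R] so that [l] has
    the right upper limit from the left and from the right at each point.
    Since [l] is upper semicontinuous, this only asks that on both sides of a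
    point [x] with [l x > 0], arbitrarily close to [x], there be points where
    [l] is nearly as large as [l x] ([straight_model]); such an [x] is then
    never an end point of the image.

    The order is constructed by refining finite ordered clopen partitions.
    Given a clopen piece [V] and [e > 0], it suffices to cut [V] into clopen
    pieces whose maxima of [l], read from left to right, climb from below [e] to
    the maximum by steps of size at most [e] and then descend again: every
    point of height at least [e] then has points of [V] on either side that are
    lower by at most about [e].  This works by induction on the height of [V]
    ([flanked_order_of_bound]): the intermediate values of [l] and its
    semicontinuity provide two disjoint clopen pieces that are slightly lower
    than [V]; the inductively ordered pieces go to the left and to the right of
    the rest of [V].  Iterating with [e = 1/(n+1)] and splitting also by the
    [n]-th coordinate of the Cantor space yields integer ranks
    [f_0, f_1, ...], each refining the previous one ([flanked_ranks]), and the
    corresponding mixed radix expansions converge to the embedding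
    ([rank_embedding]). *)

(** * Locally constant functions *)

Section LocallyConstant.
Context {T : topologicalType}.

Definition locally_constant {S : Type} (f : T -> S) : Prop :=
  forall x, \forall y \near x, f y = f x.

Lemma locally_constant_cst (S : Type) (s : S) : locally_constant (fun=> s).
Proof. by move=> x; exact: nearW. Qed.

Lemma locally_constant_comp2 (S1 S2 S3 : Type) (F : S1 -> S2 -> S3)
    (f : T -> S1) (g : T -> S2) :
  locally_constant f -> locally_constant g ->
  locally_constant (fun x => F (f x) (g x)).
Proof.
by move=> cf cg x; apply: filterS2 (cf x) (cg x) => y -> ->.
Qed.

Lemma locally_constant_comp (S1 S2 : Type) (F : S1 -> S2) (f : T -> S1) :
  locally_constant f -> locally_constant (F \o f).
Proof. by move=> cf x; apply: filterS (cf x) => y /= ->. Qed.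

Lemma locally_constant_fiberwise (S1 S2 : Type) (f : T -> S1)
    (g : S1 -> T -> S2) :
  locally_constant f -> (forall s, locally_constant (g s)) ->
  locally_constant (fun x => g (f x) x).
Proof.
by move=> cf cg x; apply: filterS2 (cf x) (cg (f x) x) => y -> ->.
Qed.

End LocallyConstant.

(** * Ordering clopen pieces by height *)

Section OrderingPieces.
Context {R : realType} {T : topologicalType} (l : T -> R).

(** The requirement on one stage of the order: [i] ranks the points of the
    piece [V], and a point that is not low has almost equally high points of
    the same piece on both sides. *)
Definition flanked (V : T -> bool) (i : T -> nat) (e : R) : Prop :=
  forall x, V x -> e <= l x ->
    (exists y, [/\ V y, (i y < i x)%N & l x - e < l y]) /\
    (exists z, [/\ V z, (i x < i z)%N & l x - e < l z]).

(** The only consequence of semicontinuity and of the density of tips that the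
    construction of the order uses: below any height reached in a clopen piece
    there is a clopen subpiece whose supremum lies in a prescribed interval. *)
Definition has_thin_pieces : Prop :=
  forall (V : T -> bool) x a b, locally_constant V -> V x ->
    0 <= a -> a < b -> b <= l x ->
    exists W : T -> bool, [/\ locally_constant W, forall y, W y -> V y,
      forall y, W y -> l y < b & exists2 p, W p & a < l p].

Hypothesis thin : has_thin_pieces.

(** Induction on the number of steps of size [e] needed to reach the height of
    [V].  If [l] reaches [k.+1 * e] somewhere in [V], choose disjoint clopen
    pieces [L] and [N] of height between [k * e] and [k.+1 * e], order them by
    induction, and put them to the left and to the right of the rest of [V].
    A point of the rest is lower than [k.+2 * e], hence less than [e * 2] above
    the witnesses in [L] and in [N]. *)
Lemma flanked_order_of_bound (e : R) (k : nat) (V : T -> bool) :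
  0 < e -> locally_constant V -> (forall x, V x -> l x < k.+1%:R * e) ->
  exists i : T -> nat, exists K : nat,
    [/\ locally_constant i, forall x, (i x <= K)%N & flanked V i (e * 2)].
Proof.
move=> e0; elim: k V => [|k IH] V cV Vle.
  exists (fun=> 0%N), 0%N; split => //; first exact: locally_constant_cst.
  by move=> x /Vle lx /le_lt_trans/(_ lx); rewrite mul1r => ?; exfalso; lra.
have ke0 : 0 <= k%:R * e by rewrite mulr_ge0// ltW.
have kS : k.+1%:R * e = k%:R * e + e by rewrite -natr1 mulrDl mul1r.
have kSS : k.+2%:R * e = k%:R * e + e * 2 by rewrite -!natr1; lra.
have [[x0 Vx0 lx0]|low] := pselect (exists2 x, V x & k.+1%:R * e <= l x); last first.
  apply: IH => // x Vx; rewrite ltNge; apply/negP => lx.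
  by apply: low; exists x.
have kltkS : k%:R * e < k.+1%:R * e by rewrite kS ltrDl.
have [L [cL LV Ll [p Lp lp]]] := thin cV Vx0 ke0 kltkS lx0.
have cVL : locally_constant (fun x => V x && ~~ L x).
  exact: (locally_constant_comp2 (fun u v => u && ~~ v)).
(* [L] is lower than [x0], so [x0] is still available after removing [L]. *)
have VLx0 : V x0 && ~~ L x0.
  by rewrite Vx0; apply/negP => /Ll; rewrite ltNge lx0.
have [N [cN NVL Nl [q Nq lq]]] := thin cVL VLx0 ke0 kltkS lx0.
have NV y : N y -> V y by move=> /NVL/andP[].
have LN y : N y -> L y = false by move=> /NVL/andP[_ /negbTE].
have [i [K [ci iK fi]]] := IH L cL Ll.
have [j [M [cj jM fj]]] := IH N cN Nl.
(* The ranks of [L] end at [K], those of [N] start at [K.+2]; in between, the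
   rest gets [K.+1]. *)
exists (fun x => if L x then i x else if N x then (K.+2 + j x)%N else K.+1).
exists (K.+2 + M)%N; split.
- apply: (locally_constant_comp2 (fun u (v : nat * (bool * nat)) =>
    if u then v.1 else if v.2.1 then (K.+2 + v.2.2)%N else K.+1) cL
    (g := fun x => (i x, (N x, j x)))).
  apply: (locally_constant_comp2 pair) => //.
  exact: (locally_constant_comp2 pair).
- move=> x; case: ifP => _; last case: ifP => _.
  + by rewrite (leq_trans (iK x))//; lia.
  + by rewrite leq_add2l.
  + by lia.
- move=> x Vx ex; have := Vle x Vx; rewrite kSS => xlt.
  case: ifPn => [Lx|nLx].
    have [[y [Ly yx ly]] [z [Lz xz lz]]] := fi x Lx ex.
    split; [exists y|exists z]; rewrite ?Ly ?Lz; split => //; exact: LV.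
  case: ifPn => [Nx|nNx].
    have [[y [Ny yx ly]] [z [Nz xz lz]]] := fj x Nx ex.
    split; [exists y|exists z]; rewrite LN// ?Ny ?Nz ltn_add2l.
      by split => //; exact: NV.
    by split => //; exact: NV.
  split; [exists p; rewrite Lp|exists q; rewrite LN// Nq]; split.
  + exact: LV.
  + by rewrite ltnS.
  + lra.
  + exact: NV.
  + by rewrite addSn ltnS leq_addr.
  + lra.
Qed.

Hypothesis bounded : exists M, forall x, l x <= M.

Lemma flanked_order (e : R) (V : T -> bool) :
  0 < e -> locally_constant V ->
  exists i : T -> nat, exists K : nat,
    [/\ locally_constant i, forall x, (i x <= K)%N & flanked V i e].
Proof.
move=> e0 cV; have [M lM] := bounded.
have e20 : 0 < e / 2 by rewrite divr_gt0.
have := @flanked_order_of_bound (e / 2) (Num.truncn (M / (e / 2))) V e20 cV.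
rewrite divfK// => H; apply: H => x _.
by rewrite (le_lt_trans (lM x))// -ltr_pdivrMr// truncnS_gt.
Qed.

(** The fibers of a bounded locally constant [f] are finitely many clopen
    pieces, which can be ordered independently of each other. *)
Lemma flanked_order_fibers (e : R) (f : T -> nat) (B : nat) :
  0 < e -> locally_constant f -> (forall x, (f x <= B)%N) ->
  exists i : T -> nat, exists K : nat,
    [/\ locally_constant i, forall x, (i x <= K)%N &
        forall v, flanked (fun x => f x == v) i e].
Proof.
move=> e0 cf fB.
have /choice[i /choice[K iK]] : forall v : nat, exists i : T -> nat,
    exists K : nat, [/\ locally_constant i, forall x, (i x <= K)%N &
    flanked (fun x => f x == v) i e].
  move=> v; apply: flanked_order => //.
  exact: (locally_constant_comp (fun u => u == v)).
exists (fun x => i (f x) x), (\max_(v < B.+1) K v); split.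
- apply: locally_constant_fiberwise => // v; by have [] := iK v.
- move=> x; have [_ /(_ x) + _] := iK (f x); move=> /leq_trans; apply.
  have fxB : (f x < B.+1)%N by rewrite ltnS.
  exact: (@leq_bigmax _ (fun v : 'I_B.+1 => K v) (Ordinal fxB)).
- move=> v x /eqP fx ex; have [_ _ /(_ x)] := iK v.
  rewrite fx eqxx => /(_ isT ex) [[y [/eqP fy ? ?]] [z [/eqP fz ? ?]]].
  by split; [exists y; rewrite fy|exists z; rewrite fz].
Qed.

(** The sequence [c] records the coordinates that the ranks have to separate. *)
Variable c : nat -> T -> bool.
Hypothesis cc : forall n, locally_constant (c n).

(** Points of a fiber of [f] are ranked first by the bit [c n] and then by an
    order that is flanked on the common fibers of [f] and [c n]; such an order
    is flanked on the fibers of [f].  The conclusion is conditional on [f] so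
    that a choice function over all [f] can be iterated.  The factor 2 in
    [(Ar.2 x).*2 < Ar.1] leaves gaps between the intervals of the mixed radix
    expansion, which makes its limit injective. *)
Lemma flanked_rank_step (n : nat) (f : T -> nat) :
  exists Ar : nat * (T -> nat),
  locally_constant f -> (exists B : nat, forall x, (f x <= B)%N) ->
  [/\ locally_constant Ar.2, forall x, ((Ar.2 x).*2 < Ar.1)%N,
      forall x y, Ar.2 x = Ar.2 y -> c n x = c n y, (1 < Ar.1)%N &
      forall v, flanked (fun x => f x == v) Ar.2 n.+1%:R^-1].
Proof.
have [cf|] := pselect (locally_constant f); last by exists (0%N, f).
have [[B fB]|] := pselect (exists B : nat, forall x, (f x <= B)%N); last first.
  by exists (0%N, f).
pose f' x := (f x).*2 + c n x.
have cf' : locally_constant f'.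
  by apply: (locally_constant_comp2 (fun u (v : bool) => u.*2 + v)%N).
have f'B x : (f' x <= B.*2.+1)%N.
  by have := fB x; rewrite /f'; case: (c n x); lia.
have [i [K [ci iK fi]]] :=
  @flanked_order_fibers n.+1%:R^-1 f' _ (ltac:(by rewrite invr_gt0)) cf' f'B.
exists (K.*2.+2.*2, fun x => (c n x) * K.+1 + i x)%N => _ _ /=; split.
- by apply: (locally_constant_comp2 (fun (u : bool) v => u * K.+1 + v)%N).
- by move=> x; have := iK x; case: (c n x); lia.
- move=> x y; have := iK x; have := iK y.
  by case: (c n x); case: (c n y) => //=; lia.
- by [].
- move=> v x /eqP fx ex; have := fi (f' x) x (eqxx _) ex.
  have same y : f' y = f' x -> (f y == v) /\ c n y = c n x.
    by rewrite -fx /f'; case: (c n x); case: (c n y) => ?; split => //;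
      apply/eqP; lia.
  move=> [[y [/eqP/same[fy cy] yx ly]] [z [/eqP/same[fz cz] xz lz]]].
  by split; [exists y|exists z]; rewrite ?cy ?cz ltn_add2l.
Qed.

Lemma flanked_ranks :
  exists f : nat -> T -> nat, exists A : nat -> nat,
  [/\ forall n, locally_constant (f n),
      forall n, (1 < A n)%N,
      forall n x, exists2 r, (f n.+1 x = A n * f n x + r)%N & (r.*2 < A n)%N,
      forall n x y, f n.+1 x = f n.+1 y -> c n x = c n y &
      forall n v, flanked (fun x => f n x == v) (f n.+1) n.+1%:R^-1].
Proof.
have /choice[S HS] := fun nf : nat * (T -> nat) => flanked_rank_step nf.1 nf.2.
pose f := fix F n := if n is m.+1 then
  fun x => ((S (m, F m)).1 * F m x + (S (m, F m)).2 x)%N else fun=> 0%N.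
have fP n : locally_constant (f n) /\ exists B : nat, forall x, (f n x <= B)%N.
  elim: n => [|n [cf bf]]; first by split; [exact: locally_constant_cst|exists 0%N].
  have [cr rA _ _ _] := HS (n, f n) cf bf.
  have [B fB] := bf; split => /=.
    exact: (locally_constant_comp2 (fun u v => (S (n, f n)).1 * u + v)%N).
  exists ((S (n, f n)).1 * B + (S (n, f n)).1)%N => x.
  apply: leq_add; first by rewrite leq_mul2l fB orbT.
  by have := rA x; lia.
have step n := HS (n, f n) (fP n).1 (fP n).2.
exists f, (fun n => (S (n, f n)).1); split => [n|n|n x|n x y|n v x Vx ex].
- exact: (fP n).1.
- by have [] := step n.
- by exists ((S (n, f n)).2 x) => //; have [_ ->] := step n.
- have [_ rA cr A1 _] := step n; move=> /= fxy; apply: cr.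
  have := rA x; have := rA y; move: fxy.
  set A := (S _).1; set rx := (S _).2 x; set ry := (S _).2 y => fxy ryA rxA.
  have : ((A * f n x + rx) %% A = (A * f n y + ry) %% A)%N by rewrite fxy.
  by rewrite ![(A * _)%N]mulnC !modnMDl !modn_small //; lia.
- have [_ _ _ _ /(_ v x Vx ex)] := step n.
  have fS y : f n.+1 y =
    ((S (n, f n)).1 * f n y + (S (n, f n)).2 y)%N by [].
  move/eqP: (Vx) => fx [[y [Vy yx ly]] [z [Vz xz lz]]].
  have fy : f n y = v := eqP Vy; have fz : f n z = v := eqP Vz.
  by split; [exists y|exists z]; split=> //; rewrite !fS fx ?fy ?fz ltn_add2l.
Qed.

End OrderingPieces.

(** * From refining ranks to real numbers *)

Section RankEmbedding.
Context {R : realType} {T : topologicalType}.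
Variables (f : nat -> T -> nat) (A : nat -> nat).
Hypothesis A1 : forall n, (1 < A n)%N.
Hypothesis fA : forall n x,
  exists2 r, (f n.+1 x = A n * f n x + r)%N & (r.*2 < A n)%N.

(** [f n x / D n] is a mixed radix expansion cut off after [n] digits.  The
    interval from [lower x n] to [upper x n] contains all longer expansions, and
    intervals of different ranks at the same stage are disjoint. *)
Let D (n : nat) : R := (\prod_(k < n) A k)%N%:R.
Let lower (x : T) (n : nat) : R := (f n x)%:R / D n.
Let upper (x : T) (n : nat) : R := ((f n x)%:R + 2^-1) / D n.

Let DS n : D n.+1 = D n * (A n)%:R.
Proof. by rewrite /D big_ord_recr natrM. Qed.

Let A0 n : 0 < (A n)%:R :> R.
Proof. by rewrite ltr0n (leq_trans _ (A1 n)). Qed.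

Let D_ge n : n.+1%:R <= D n.
Proof.
rewrite /D ler_nat; elim: n => [|n IH]; first by rewrite big_ord0.
rewrite big_ord_recr /=; apply: leq_trans (leq_mul IH (A1 n)).
by rewrite muln2 -addnn addSn ltnS addnS ltnS leq_addr.
Qed.

Let D0 n : 0 < D n.
Proof. exact: lt_le_trans (D_ge n). Qed.

Let lowerS x n : lower x n <= lower x n.+1.
Proof.
rewrite /lower DS; have [r -> _] := fA n x.
rewrite invfM mulrA ler_pdivlMr ?A0// mulrAC ler_pM2r ?invr_gt0//.
by rewrite natrD natrM mulrC lerDl.
Qed.

Let upperS x n : upper x n.+1 <= upper x n.
Proof.
rewrite /upper DS; have [r -> rA] := fA n x.
rewrite invfM mulrA ler_pdivrMr ?A0// mulrAC ler_pM2r ?invr_gt0//.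
have : r.*2.+1%:R <= (A n)%:R :> R by rewrite ler_nat.
rewrite -natr1 -muln2 natrM natrD natrM; lra.
Qed.

Let lower_upper x n m : lower x n <= upper x m.
Proof.
have lu k : lower x k <= upper x k.
  by rewrite ler_pM2r ?invr_gt0// lerDl.
have [nm|/ltnW mn] := leqP n m.
  apply: le_trans (lu m); elim: m nm => [|m IH].
    by rewrite leqn0 => /eqP ->.
  by rewrite leq_eqVlt => /predU1P[->//|/IH/le_trans]; apply.
apply: le_trans (lu n) _; elim: n mn => [|n IH].
  by rewrite leqn0 => /eqP ->.
rewrite leq_eqVlt => /predU1P[->//|/IH]; exact/le_trans.
Qed.

Let h (x : T) : R := sup (range (lower x)).

Let lower_le x n : lower x n <= h x.
Proof.
by apply: ub_le_sup; [exists (upper x 0%N) => _ [k _ <-]|exists n].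
Qed.

Let upper_ge x n : h x <= upper x n.
Proof. by apply: ge_sup => [|_ [k _ <-]//]; exists (lower x 0%N); exists 0%N. Qed.

(** The limit of the nested intervals: disjointness gives strict monotonicity,
    and equality of the [n]-th ranks confines two values to one interval of
    length at most [1/(n+1)]. *)
Lemma rank_embedding : (forall n, locally_constant (f n)) ->
  exists h : T -> R,
  [/\ continuous h, forall n x y, (f n x < f n y)%N -> h x < h y &
      forall n x y, f n x = f n y -> `|h x - h y| <= n.+1%:R^-1].
Proof.
move=> cf.
have close n x y : f n x = f n y -> `|h x - h y| <= n.+1%:R^-1.
  move=> fxy; have := lower_le x n; have := lower_le y n.
  have := upper_ge x n; have := upper_ge y n.
  rewrite /lower /upper fxy mulrDl; set u := (f n y)%:R / D n.
  have : (D n)^-1 <= n.+1%:R^-1 by rewrite lef_pV2 ?posrE.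
  have : 0 < (D n)^-1 by rewrite invr_gt0.
  move: (D n)^-1 (h x) (h y) (n.+1%:R^-1 : R) => d hx hy k.
  by rewrite ler_norml => ? ? ? ? ? ?; apply/andP; split; lra.
exists h; split => //; last first.
  move=> n x y fxy; apply: le_lt_trans (upper_ge x n) _.
  apply: lt_le_trans (lower_le y n); rewrite ltr_pM2r ?invr_gt0//.
  have : (f n x).+1%:R <= (f n y)%:R :> R by rewrite ler_nat.
  by rewrite -natr1; lra.
move=> x; apply/cvgrPdist_lt => e e0.
have [n _ /(_ n (leqnn n)) ne] := near_infty_natSinv_lt (PosNum e0).
near=> y; apply: le_lt_trans ne; apply: close; apply/esym.
by near: y; exact: cf.
Unshelve. all: by end_near. Qed.

End RankEmbedding.

(** * Continuous injections of compact sets *)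

Section CompactInjective.
Context {T U : topologicalType}.

(** The map [f] sends closed subsets of [A] to compact, hence closed sets. *)
Lemma compact_inverse_continuous (A : set T) (f : T -> U) (g : U -> T) :
  hausdorff_space U -> compact A -> {within A, continuous f} ->
  (forall x, A x -> g (f x) = x) -> {within f @` A, continuous g}.
Proof.
move=> hU cA cf gf; apply/continuous_closedP => K cK.
apply/closed_subspaceP; exists (f @` (A `&` K)).
  apply: compact_closed => //; apply: continuous_compact.
    by apply: continuous_subspaceW cf; exact: subIsetl.
  exact: compact_closedI.
apply/seteqP; split => [u [[x [Ax Kx] <-] _]|u [Ku [x Ax xu]]].
  have Kgf : K (g (f x)) by rewrite gf.
  by split; [exact: Kgf|exists x].
have Kgu : K (g u) := Ku; rewrite -xu gf// in Kgu.
by split; exists x.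
Qed.

Lemma compact_injective_homeomorphism_on (A : set T) (f : T -> U) (t0 : T) :
  hausdorff_space U -> compact A -> {within A, continuous f} ->
  {in A &, injective f} -> homeomorphism_on A (f @` A) f.
Proof.
move=> hU cA cf fI.
have /choice[g gP] : forall u, exists x, (f @` A) u -> A x /\ f x = u.
  move=> u; have [[x Ax <-]|nu] := pselect ((f @` A) u).
    by exists x.
  by exists t0 => /nu.
have gf x : A x -> g (f x) = x.
  move=> Ax; have [|Agx fgx] := gP (f x); first by exists x.
  by apply: fI; rewrite ?inE.
split=> //; last first.
  exists g => [|x]; last by rewrite inE; exact: gf.
  exact: compact_inverse_continuous.
by split => [x Ax|//|//]; exists x.
Qed.

End CompactInjective.

(** * Straight hairy Cantor sets from embeddings of the Cantor space *)

Section LimfEsup.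
Context {R : realType}.

(** [S] selects the punctured, the left or the right neighborhoods of [x]. *)
Lemma limf_esup_within_eq (f : R -> R) (x L : R) (C S : set R) :
  (forall c, L < c -> \forall t \near x, C t -> f t <= c) ->
  (forall c d, c < L -> 0 < d ->
    exists t, [/\ C t, S t, `|x - t| < d & c <= f t]) ->
  limf_esup (fun t => (f t)%:E) (within C (within S (nbhs x))) = L%:E.
Proof.
move=> fle fge; apply/eqP; rewrite eq_le; apply/andP; split.
  apply/lee_addgt0Pr => e e0; rewrite -EFinD.
  have /fle near_le : L < L + e by rewrite ltrDl.
  apply: ge_ereal_inf.
  exists (ereal_sup [set (f t)%:E | t in [set t | C t -> f t <= L + e] `&` C]).
    exists ([set t | C t -> f t <= L + e] `&` C) => //.
    rewrite /within/=; apply: filterS near_le => t ft _ Ct; split => //.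
  by apply: ge_ereal_sup => _ [t [/= ft Ct] <-]; rewrite lee_fin; exact: ft.
apply: le_ereal_inf_tmp => _ [V nV <-].
apply/lee_subgt0Pr => e e0; rewrite -EFinB.
move: nV; rewrite /within/= => /nbhs_ballP[d /= d0 dV].
have [|t [Ct St xt ft]] := fge (L - e) d _ d0; first by rewrite ltrBlDr ltrDl.
apply: le_ereal_sup_tmp; exists (f t)%:E; last by rewrite lee_fin.
by exists t => //; exact: dV.
Qed.

End LimfEsup.

Section StraightModel.
Context {R : realType}.
Variables (l h : cantor_space -> R).
Hypothesis hc : continuous h.
Hypothesis hI : injective h.
Hypothesis l0 : forall a, 0 <= l a.
Hypothesis usc : forall a c, l a < c -> \forall b \near a, l b < c.
Hypothesis pos_dense : forall (a : cantor_space) (U : set cantor_space), nbhs a U ->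
  exists2 b, U b & 0 < l b.
Hypothesis left_high : forall (a : cantor_space) (d : R), 0 < d -> 0 < l a ->
  exists b, [/\ h a - d < h b, h b < h a & l a - d < l b].
Hypothesis right_high : forall (a : cantor_space) (d : R), 0 < d -> 0 < l a ->
  exists b, [/\ h a < h b, h b < h a + d & l a - d < l b].

(** Upper semicontinuity bounds every upper limit by the value.  Conversely, at
    a point of positive height the two flanking hypotheses give both one-sided
    lower bounds and exclude that it is an end point; at a point of height 0
    the lower bound only needs the existence of points nearby, given by
    [pos_dense] at end points and by the absence of gaps elsewhere. *)
Lemma straight_model : straight_hairy_cantor_set
  [set p : R * R | exists2 a, p.1 = h a & 0 <= p.2 <= l a].
Proof.
have hom : homeomorphism_on [set: cantor_space] (range h) h.
  apply: (compact_injective_homeomorphism_on point) => //.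
  - exact: cantor_space_compact.
  - exact: continuous_subspaceT.
  - by move=> a b _ _; exact: hI.
have [_ _ [g gc gK]] := hom.
have gh : cancel h g by move=> a; apply: gK; rewrite inE.
have Ccantor : cantor_set (range h) by exists h.
pose C := range h.
have usc_l a c : l a < c -> \forall t \near h a, C t -> l (g t) <= c.
  move=> lac; have Cha : range h (h a) by exists a.
  have gca : g @ within (range h) (nbhs (h a)) --> g (h a).
    exact: ((subspace_continuousP _ _).1 gc).
  rewrite gh in gca.
  have : \forall t \near h a, C t -> l (g t) < c := gca _ (usc lac).
  by apply: filterS => t /[apply] /ltW.
have dense_pos a (d : R) : 0 < d -> exists b, [/\ 0 < l b & `|h a - h b| < d].
  move=> d0; have /cvgrPdist_lt/(_ d d0) := @hc a.
  by move=> /pos_dense[b hb lb]; exists b.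
exists C, (l \o g); split.
  split => //; first by move=> _ [a _ <-] /=; rewrite gh.
  apply/seteqP; split => [[x y] [a /= -> ay]|[x y] /= [[a _ <-]]].
    by rewrite gh; split => //; exists a.
  by rewrite gh => ?; exists a.
have pos_not_end a : 0 < l a -> ~ cantor_end_point C (h a).
  move=> la [_ [d d0 [|]]]; rewrite -subset0.
    have [b [hab hbd _]] := right_high d0 la; move=> /(_ (h b)); apply.
    by split; [rewrite /= in_itv /= hab|exists b].
  have [b [hab hbd _]] := left_high d0 la; move=> /(_ (h b)); apply.
  by split; [rewrite /= in_itv /= hab|exists b].
split.
- move=> _ [a _ <-] B /nbhs_ballP[d /= d0 dB].
  have [b [lb ab]] := dense_pos a d d0.
  by exists (h b); split; [split; [exists b|rewrite /= gh]|exact: dB].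
- move=> _ [[a _ <-]] ea; rewrite /= gh.
  have la : l a = 0.
    apply/eqP; rewrite eq_le l0 andbT leNgt; apply/negP => /pos_not_end; apply.
    by split => //; exists a.
  split => //; apply: limf_esup_within_eq => [c|c d c0 d0].
    by rewrite -la; exact: usc_l.
  have [b [lb ab]] := dense_pos a d d0.
  exists (h b); split => //=; first by exists b.
    by apply/eqP => /hI ba; rewrite ba la ltxx in lb.
  by rewrite gh ltW// (lt_trans c0).
- move=> _ [a _ <-] nea; rewrite /= gh.
  have [la|la] := leP (l a) 0; last first.
    split; apply: limf_esup_within_eq => [c|c d cl d0]; first exact: usc_l.
    + have [|b [hb ba lb]] := @left_high a (Num.min d (l a - c)) _ la.
        by rewrite lt_min d0 subr_gt0.
      move: hb lb; rewrite ltrBlDr -ltrBlDl lt_min => /andP[hb _].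
      rewrite ltrBlDr -ltrBlDl lt_min ltrD2l ltrN2 => /andP[_ lb].
      exists (h b); split => //; first by exists b.
        by rewrite gtr0_norm ?subr_gt0.
      by rewrite gh ltW.
    + exact: usc_l.
    + have [|b [ba hb lb]] := @right_high a (Num.min d (l a - c)) _ la.
        by rewrite lt_min d0 subr_gt0.
      move: hb lb; rewrite -ltrBlDl lt_min => /andP[hb _].
      rewrite ltrBlDr -ltrBlDl lt_min ltrD2l ltrN2 => /andP[_ lb].
      exists (h b); split => //; first by exists b.
        by rewrite distrC gtr0_norm ?subr_gt0.
      by rewrite gh ltW.
  have {la} la : l a = 0 by apply/eqP; rewrite eq_le l0 la.
  have side (S I : set R) d : I `&` C !=set0 ->
    (forall t, I t -> S t /\ `|h a - t| < d) ->
    exists b, S (h b) /\ `|h a - h b| < d.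
    by move=> [t [It [b _ bt]]] /(_ _ It); rewrite -bt; exists b.
  have nonempty (I : R -> set R) (d : R) : 0 < d ->
      (I d `&` C = set0 -> cantor_end_point C (h a)) -> I d `&` C !=set0.
    move=> d0 HI; apply/set0P/eqP => /HI; exact: nea.
  have Ca : C (h a) by exists a.
  split; apply: limf_esup_within_eq => [c|c d cl d0]; try exact: usc_l.
  + have [b [Sb bd]] : exists b, h b < h a /\ `|h a - h b| < d.
      apply: (side (fun t => t < h a) (`]h a - d, h a[%classic)).
        apply: (nonempty (fun d => `]h a - d, h a[%classic)) => // E.
        by split => //; exists d => //; right.
      move=> t /=; rewrite in_itv /= => /andP[ht ta]; split => //.
      by rewrite gtr0_norm ?subr_gt0// ltrBlDr -ltrBlDl.
    by exists (h b); split => //; [exists b|rewrite gh (le_trans (ltW cl))// la].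
  + have [b [Sb bd]] : exists b, h a < h b /\ `|h a - h b| < d.
      apply: (side (fun t => h a < t) (`]h a, h a + d[%classic)).
        apply: (nonempty (fun d => `]h a, h a + d[%classic)) => // E.
        by split => //; exists d => //; left.
      move=> t /=; rewrite in_itv /= => /andP[ht ta]; split => //.
      by rewrite distrC gtr0_norm ?subr_gt0// ltrBlDl.
    by exists (h b); split => //; [exists b|rewrite gh (le_trans (ltW cl))// la].
Qed.

End StraightModel.

(** * Height functions on the Cantor space *)

Section CantorHeights.
Context {R : realType}.

Lemma clopen_locally_constant (T : topologicalType) (D : set T) :
  clopen D -> locally_constant (fun x => `[< D x >]).
Proof.
move=> [oD cD] x; have [Dx|nDx] := pselect (D x).
  have : nbhs x D by exact: open_nbhs_nbhs.
  by apply: filterS => y Dy; rewrite !asboolT.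
have : nbhs x (~` D) by apply: open_nbhs_nbhs; split => //; exact: closed_openC.
by apply: filterS => y nDy; rewrite !asboolF.
Qed.

Lemma cantor_clopen_nbhs (a : cantor_space) (U : set cantor_space) : nbhs a U ->
  exists V : cantor_space -> bool,
    [/\ locally_constant V, V a & forall b, V b -> U b].
Proof.
move=> /(zero_dimensional_cvg cantor_space_hausdorff cantor_zero_dimensional
  cantor_space_compact)[D [Da cD] DU].
exists (fun x => `[< D x >]); split; [exact: clopen_locally_constant| |].
  exact/asboolP.
by move=> b /asboolP; exact: DU.
Qed.

Lemma locally_constant_coordinate (n : nat) :
  locally_constant (fun x : cantor_space => x n).
Proof.
move=> x.
have /(_ [set x n]) := @proj_continuous nat (fun=> bool : topologicalType) n x.
apply; exact: discrete_set1.
Qed.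

Variable l : cantor_space -> R.
Hypothesis l0 : forall a, 0 <= l a.
Hypothesis bounded : exists M, forall a, l a <= M.
Hypothesis usc : forall a c, l a < c -> \forall b \near a, l b < c.
Hypothesis pos_dense : forall (a : cantor_space) (U : set cantor_space),
  nbhs a U -> exists2 b, U b & 0 < l b.
Hypothesis intermediate :
  forall (a : cantor_space) (U : set cantor_space) (u v : R),
  nbhs a U -> 0 <= u -> u < v -> v <= l a ->
  exists p, [/\ U p, u < l p & l p < v].

(** Some point [p] of the piece has height strictly between the two bounds, and
    semicontinuity keeps a clopen neighborhood of [p] below the upper one. *)
Lemma usc_has_thin_pieces : has_thin_pieces l.
Proof.
move=> V x u v cV Vx u0 uv vl.
have nV : nbhs x [set y | V y] by apply: filterS (cV x) => y /= ->.
have [p [/= Vp up pv]] := intermediate nV u0 uv vl.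
have nW : nbhs p [set y | V y /\ l y < v].
  by apply: filterS2 (cV p) (usc pv) => y /= -> ?.
have [W [cW Wp WU]] := cantor_clopen_nbhs nW.
by exists W; split => // [y /WU[]|y /WU[]|]//; exists p.
Qed.

(** Given [d > 0] and [a], the stage [n] with [1/(n+1) < min d (l a)] provides
    the flanking points: they share the [n]-th rank of [a], hence are close to
    [a] in the image, and differ from it in the next rank. *)
Lemma balanced_embedding : exists h : cantor_space -> R,
  [/\ continuous h, injective h,
    forall (a : cantor_space) (d : R), 0 < d -> 0 < l a ->
      exists b, [/\ h a - d < h b, h b < h a & l a - d < l b] &
    forall (a : cantor_space) (d : R), 0 < d -> 0 < l a ->
      exists b, [/\ h a < h b, h b < h a + d & l a - d < l b]].
Proof.
have [f [A [cf A1 fA fc fl]]] :=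
  flanked_ranks usc_has_thin_pieces bounded locally_constant_coordinate.
have [h [hc hlt hclose]] := @rank_embedding R _ f A A1 fA cf.
have flank a d : 0 < d -> 0 < l a ->
    (exists b, [/\ `|h a - h b| < d, h b < h a & l a - d < l b]) /\
    (exists b, [/\ `|h a - h b| < d, h a < h b & l a - d < l b]).
  move=> d0 la; have m0 : 0 < Num.min d (l a) by rewrite lt_min d0.
  have [n _ /(_ n (leqnn n)) /=] := near_infty_natSinv_lt (PosNum m0).
  rewrite lt_min => /andP[nd /ltW nl].
  have [[b [/eqP fb ba lb]] [b' [/eqP fb' ab' lb']]] := fl n (f n a) a (eqxx _) nl.
  split; [exists b|exists b']; split.
  - by apply: le_lt_trans nd; apply: hclose.
  - exact: hlt ba.
  - by apply: le_lt_trans lb; rewrite lerD2l lerN2 ltW.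
  - by apply: le_lt_trans nd; apply: hclose.
  - exact: hlt ab'.
  - by apply: le_lt_trans lb'; rewrite lerD2l lerN2 ltW.
exists h; split => //.
- move=> a b hab; apply: functional_extensionality_dep => n.
  have fab : f n.+1 a = f n.+1 b.
    by apply/eqP; case: ltngtP => // /hlt; rewrite hab ltxx.
  exact: (fc n a b fab).
- move=> a d d0 la; have [[b [hd ba lb]] _] := flank a d d0 la.
  exists b; split => //; rewrite ltrBlDr -ltrBlDl.
  exact: le_lt_trans (ler_norm _) hd.
- move=> a d d0 la; have [_ [b [hd ba lb]]] := flank a d d0 la.
  exists b; split => //; rewrite -ltrBlDl.
  by apply: le_lt_trans hd; rewrite distrC ler_norm.
Qed.

Lemma straight_embedding : exists h : cantor_space -> R,
  [/\ continuous h, injective h & straight_hairy_cantor_set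
    [set p : R * R | exists2 a, p.1 = h a & 0 <= p.2 <= l a]].
Proof.
have [h [hc hI hL hR]] := balanced_embedding.
by exists h; split => //; exact: straight_model.
Qed.

End CantorHeights.

(** * Geometrically weighted sums *)

Section WeightedSum.
Context {R : realType}.

Definition weighted_sum (u : nat -> R) : R :=
  limn (series (fun n => u n * 2^-1 ^+ n)).

Lemma cvg_geometric_half (a : R) :
  series (geometric a 2^-1) @ \oo --> a * 2.
Proof.
have two : (1 - 2^-1)^-1 = 2 :> R.
  by rewrite (_ : 1 - 2^-1 = 2^-1 :> R) ?invrK//; lra.
have := @cvg_geometric_series R a 2^-1; rewrite two; apply.
by rewrite ger0_norm// invf_lt1// ltr1n.
Qed.

Lemma cvg_weighted_sum (u : nat -> R) (M : R) :
  (forall n, 0 <= u n <= M) -> cvgn (series (fun n => u n * 2^-1 ^+ n)).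
Proof.
move=> uM; apply: (@series_le_cvg _ _ (geometric M 2^-1)).
- by move=> n; have /andP[u0 _] := uM n; rewrite mulr_ge0.
- move=> n; have /andP[u0 uM'] := uM n.
  by rewrite /geometric/= mulr_ge0// (le_trans u0).
- by move=> n; have /andP[_ uM'] := uM n; rewrite /geometric/= ler_pM2r.
- by apply: cvgP; exact: cvg_geometric_half.
Qed.

Lemma weighted_sum_le (u v : nat -> R) (M e : R) :
  (forall n, 0 <= u n <= M) -> (forall n, 0 <= v n <= M) ->
  (forall n, u n <= v n + e) -> weighted_sum u <= weighted_sum v + e * 2.
Proof.
move=> uM vM uv; have cu := cvg_weighted_sum uM; have cv := cvg_weighted_sum vM.
have ce := @cvg_geometric_half e.
rewrite -(cvg_lim _ ce)//; rewrite /weighted_sum -lim_seriesD//; last first.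
  exact: cvgP ce.
apply: lim_series_le => //; first by apply: is_cvg_seriesD => //; exact: cvgP ce.
by move=> n; rewrite /geometric /= -mulrDl ler_pM2r.
Qed.

Lemma weighted_sum_lt (u v : nat -> R) (M : R) (k : nat) :
  (forall n, 0 <= u n <= M) -> (forall n, 0 <= v n <= M) ->
  (forall n, u n <= v n) -> u k < v k -> weighted_sum u < weighted_sum v.
Proof.
move=> uM vM uv uvk; have cu := cvg_weighted_sum uM; have cv := cvg_weighted_sum vM.
rewrite -subr_gt0 /weighted_sum -lim_seriesB//.
set w := (w in series w).
have w0 n : 0 <= w n.
  by rewrite /w /= -mulrBl mulr_ge0// subr_ge0.
have wk : 0 < series w k.+1.
  rewrite seriesEnat /= big_nat_recr//= ltr_wpDl//.
    by apply: sumr_ge0.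
  by rewrite /w /= -mulrBl mulr_gt0// subr_gt0.
apply: (lt_le_trans wk); apply: nondecreasing_cvgn_le.
  exact: nondecreasing_series.
exact: is_cvg_seriesB.
Qed.

Lemma weighted_sum0 (u : nat -> R) :
  (forall n, u n = 0) -> weighted_sum u = 0.
Proof.
move=> u0; rewrite /weighted_sum (_ : series _ = fun=> 0) ?lim_cst//.
by apply/funext => n; rewrite seriesEnat /= big1// => i _; rewrite u0 mul0r.
Qed.

End WeightedSum.

(** * Distance to a set in a compact metric space *)

Section SetDistance.
Context {R : realType} {X : metricType R}.
Implicit Types (q : X) (A : set X).

Definition set_dist q A : R := inf [set mdist q a | a in A].

Lemma set_dist_le q A a : A a -> set_dist q A <= mdist q a.
Proof.
by move=> Aa; apply: ge_inf; [exists 0 => _ [? _ <-]; exact: mdist_ge0|exists a].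
Qed.

Lemma le_set_dist q A r : A !=set0 -> (forall a, A a -> r <= mdist q a) ->
  r <= set_dist q A.
Proof.
move=> [a Aa] rA; apply: lb_le_inf; first by exists (mdist q a); exists a.
by move=> _ [? ? <-]; exact: rA.
Qed.

Lemma set_dist_hausdorff q A A' e : A' !=set0 ->
  hausdorff_close A A' e -> set_dist q A <= set_dist q A' + e.
Proof.
move=> A'0 [e0 _ A'A]; rewrite -lerBlDr; apply: le_set_dist => // a' Aa'.
have [a Aa] := A'A _ Aa'; rewrite ballEmdist /= => /ltW aa'.
rewrite lerBlDr (le_trans (set_dist_le q Aa))//.
by rewrite (le_trans (metric_triangle _ a' _))// lerD2l metric_sym.
Qed.

Lemma compact_mdist_bounded : compact [set: X] ->
  exists M : R, forall x y : X, mdist x y <= M.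
Proof.
have [[x0 _]|nX] := pselect ([set: X] !=set0); last first.
  by exists 0 => x; case: nX; exists x.
move=> /compact_near_coveringP/(_ R +oo (fun M x => mdist x0 x <= M)).
case.
  move=> x _; exists (ball x 1, [set M : R | mdist x0 x + 1 <= M]) => /=.
    by split; [exact: nbhsx_ballx|apply: nbhs_pinfty_ge; exact: num_real].
  move=> [y M] /= []; rewrite ballEmdist/= => /ltW xy; apply: le_trans.
  by rewrite (le_trans (metric_triangle _ x _))// lerD2l.
move=> N [_ NM]; exists ((N + 1) + (N + 1)) => x y.
have H z : mdist x0 z <= N + 1 by apply: (NM (N + 1)) => //; rewrite ltrDl.
by rewrite (le_trans (metric_triangle _ x0 _))// lerD// metric_sym.
Qed.

(** Finite [1/(n+1)]-nets exist since finite lists, directed by inclusion, form a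
    filter along which compactness applies.  The sequence enumerates all nets
    through the pairing of natural numbers. *)
Lemma compact_dense_sequence (x0 : X) : compact [set: X] ->
  exists q : nat -> X, forall (x : X) (e : R), 0 < e ->
    exists n, mdist (q n) x < e.
Proof.
move=> /compact_near_coveringP cX.
have /choice[s sP] : forall n : nat, exists s : seq X,
    forall x, exists2 y, y \in s & mdist y x < n.+1%:R^-1.
  move=> n; pose F := filter_from [set: seq X]
    (fun s => [set t : seq X | {subset s <= t}]).
  have FF : Filter F.
    apply: filter_from_filter; first by exists [::].
    move=> s t _ _; exists (s ++ t) => // u /= sub; split => y ys; apply: sub.
      by rewrite mem_cat ys.
    by rewrite mem_cat ys orbT.
  have [|s _ sP] := cX _ F
    (fun s x => exists2 y, y \in s & mdist y x < n.+1%:R^-1) FF.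
    move=> x _; exists (ball x n.+1%:R^-1, [set t : seq X | x \in t]) => /=.
      split; first exact: nbhsx_ballx.
      by exists [:: x] => // t /= /(_ x); apply; rewrite mem_head.
    move=> [y t] /= []; rewrite ballEmdist /= => xy xt; by exists x.
  by exists s => x; exact: (sP s).
pose q k := if unpickle k is Some (n, m) then nth x0 (s n) m else x0.
exists q => x e e0.
have [n _ /(_ n (leqnn n)) ne] := near_infty_natSinv_lt (PosNum e0).
have [y ys yx] := sP n x.
exists (pickle (n, index y (s n))); rewrite /q pickleK nth_index//.
exact: lt_trans ne.
Qed.

End SetDistance.

(** * Hairs *)

Section HairExistence.
Context {R : realType} {X : metricType R}.
Hypotheses (A1 : axiom_A1 X) (A3 : axiom_A3 X).

Local Notation base := (@hairy_base R X).
Local Notation comp := (connected_component [set: X]).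

Lemma mem_component (x : X) : comp x x.
Proof. exact: connected_component_refl. Qed.

(** A point component lies in the base; the base point of an arc component is
    provided by [axiom_A3]. *)
Lemma base_exists (x : X) : exists2 b, base b & comp b x.
Proof.
have cx : component (comp x) by exists x.
have [[z xz]|ax] := A1 cx.
  have := mem_component x; rewrite {1}xz => zx; rewrite -zx in xz.
  exists x; last exact: mem_component.
  by apply: subset_closure; exists x.
have [b + _] := A3 (conj cx ax); case/seteqP => _ /(_ b erefl)[xb bb].
by exists b => //; exact: connected_component_sym.
Qed.

(** A component is a point, or an arc that meets the base in a single point by
    [axiom_A3]. *)
Lemma base_unique (b b' : X) : base b -> base b' -> comp b b' -> b = b'.
Proof.
move=> Bb Bb' bb'; have cb : component (comp b) by exists b.
have := mem_component b; have [[z bz]|ab] := A1 cb.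
  by move: bb'; rewrite bz => -> ->.
have [c bc _] := A3 (conj cb ab) => bb.
have /= -> : [set c] b by rewrite -bc.
by have /= -> : [set c] b' by rewrite -bc.
Qed.

(** The last clause allows the constant path at a point component, so that all
    components are treated alike. *)
Definition hair (b : X) (g : R -> X) : Prop :=
  [/\ {within `[0, 1]%classic, continuous g}, g 0 = b,
      g @` `[0, 1]%classic = comp b &
      {in `[0, 1]%classic &, injective g} \/ comp b = [set b]].

Lemma hair_exists (b : X) : base b -> exists g, hair b g.
Proof.
move=> Bb; have cb : component (comp b) by exists b.
have [[z bz]|ab] := A1 cb.
  have := mem_component b; rewrite {1}bz => zb; rewrite -zb in bz.
  exists (fun=> b); split; [|by []| |by right].
    by apply: continuous_subspaceT => x; exact: cvg_cst.
  rewrite bz; apply/seteqP; split=> [_ [_ _ <-]//|_ ->].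
  by exists 0 => //=; rewrite in_itv /= lexx ler01.
have [c bc [y [g [gbij gc _] [g0 _]]]] := A3 (conj cb ab).
have cE : c = b by have /= -> : [set c] b by rewrite -bc; split => //; exact: mem_component.
exists g; split => //; first by rewrite g0.
  by apply/esym; case: gbij => gf _ gs; apply/seteqP; split => // _ [t /gf ? <-].
by left; case: gbij.
Qed.

(** A choice of parametrized hairs [g], of the foot [p x] of each point and of
    its parameter [s x] on its hair.  Fixing one parametrization per base point
    makes the arcs of two points on the same hair comparable. *)
Definition hair_system (g : X -> R -> X) (p : X -> X) (s : X -> R) : Prop :=
  [/\ forall b, base b -> hair b (g b), forall x, base (p x),
      forall x, comp (p x) x, forall x, 0 <= s x <= 1 &
      forall x, g (p x) (s x) = x].

Lemma hair_system_exists : exists g p s, hair_system g p s.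
Proof.
have /choice[p pP] : forall x, exists b, base b /\ comp b x.
  by move=> x; have [b ? ?] := base_exists x; exists b.
have /choice[g gP] : forall b, exists g, base b -> hair b g.
  move=> b; have [/hair_exists[g hg]|nb] := pselect (base b).
    by exists g.
  by exists (fun=> b) => /nb.
have /choice[s sP] : forall x, exists t, 0 <= t <= 1 /\ g (p x) t = x.
  move=> x; have [Bp px] := pP x; have [_ _ im _] := gP _ Bp.
  move: px; rewrite -im => -[t /=]; rewrite in_itv /= => t01 gt.
  by exists t.
exists g, p, s; split => [//|x|x|x|x].
- by have [] := pP x.
- by have [] := pP x.
- by have [] := sP x.
- by have [] := sP x.
Qed.

End HairExistence.

Section HairSystem.
Context {R : realType} {X : metricType R}.
Hypothesis cptX : compact [set: X].
Hypotheses (A1 : axiom_A1 X) (A3 : axiom_A3 X) (A4 : axiom_A4 X).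

Local Notation base := (@hairy_base R X).
Local Notation comp := (connected_component [set: X]).

Variables (g : X -> R -> X) (p : X -> X) (s : X -> R).
Hypothesis sys : hair_system g p s.

Let hairg : forall b, base b -> hair b (g b). Proof. by case: sys. Qed.
Let basep : forall x : X, base (p x). Proof. by case: sys. Qed.
Arguments basep : clear implicits.
Let compp : forall x, comp (p x) x. Proof. by case: sys. Qed.
Let s01 : forall x, 0 <= s x <= 1. Proof. by case: sys. Qed.
Let gps : forall x, g (p x) (s x) = x. Proof. by case: sys. Qed.

Lemma foot_eq (x y : X) : comp x y -> p x = p y.
Proof.
move=> xy; apply: (base_unique A1 A3) => //.
apply: connected_component_trans (compp x) _.
apply: connected_component_trans xy _.
exact: connected_component_sym (compp y).
Qed.

Lemma foot_base (b : X) : base b -> p b = b.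
Proof. by move=> Bb; apply: (base_unique A1 A3). Qed.

Lemma foot_comp (x y : X) : p x = p y -> comp x y.
Proof.
move=> xy; apply: (@connected_component_trans _ _ (p x)).
  exact: connected_component_sym.
by rewrite xy.
Qed.

Definition arc (x : X) : set X := g (p x) @` `[0, s x]%classic.

Lemma sub_unit (x : X) : `[0, s x]%classic `<=` (`[0, 1]%classic : set R).
Proof.
move=> t /=; rewrite !in_itv /= => /andP[-> /le_trans]; apply.
by have /andP[] := s01 x.
Qed.

Lemma arc_continuous (x : X) : {within `[0, s x]%classic, continuous (g (p x))}.
Proof.
have [gc _ _ _] := hairg (basep x); apply: continuous_subspaceW gc; exact: sub_unit.
Qed.

Lemma arc_compact (x : X) : compact (arc x).
Proof.
by apply: continuous_compact; [exact: arc_continuous|exact: segment_compact].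
Qed.

Lemma arc_foot (x : X) : arc x (p x).
Proof.
have [_ g0 _ _] := hairg (basep x); exists 0 => //=.
by rewrite in_itv /= lexx; have /andP[] := s01 x.
Qed.

Lemma arc_tip (x : X) : arc x x.
Proof.
exists (s x) => //=; rewrite in_itv /= lexx andbT.
by have /andP[] := s01 x.
Qed.

Lemma arc_comp (x y : X) : arc x y -> p y = p x.
Proof.
move=> [t /sub_unit t01 <-]; rewrite -[RHS](foot_base (basep x)).
apply/esym/foot_eq; have [_ _ <- _] := hairg (basep x).
by exists t.
Qed.

Lemma arc_base (x y : X) : base y -> arc x y -> y = p x.
Proof. by move=> By /arc_comp <-; rewrite foot_base. Qed.

Lemma hair_injective (x y : X) : p x = p y -> x <> y ->
  {in `[0, 1]%classic &, injective (g (p x))}.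
Proof.
move=> pxy xy; have [_ _ _ [//|c1]] := hairg (basep x); exfalso; apply: xy.
by have := compp x; have := compp y; rewrite -pxy c1 /= => -> ?.
Qed.

Lemma arc_base_point (b : X) : base b -> arc b = [set b].
Proof.
move=> Bb; apply/seteqP; split=> [y by_|_ ->]; last exact: arc_tip.
apply: contrapT => yb; have pyb := arc_comp by_.
have gI : {in `[0, 1]%classic &, injective (g (p b))}.
  by apply: (@hair_injective b y); [rewrite pyb|exact/nesym].
have [_ g0 _ _] := hairg (basep b).
have sb : s b = 0.
  apply: gI; rewrite ?inE /= ?in_itv /= ?s01 ?lexx ?ler01// gps g0.
  by rewrite foot_base.
case: by_ => t /=; rewrite in_itv /= sb -eq_le => /eqP <-; rewrite g0 => yE.
by apply: yb; rewrite -yE foot_base.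
Qed.

(** Off the base the hair is injectively parametrized and [0 < s x], so running
    through it backwards from [s x] to [0] joins [x] to its foot. *)
Lemma arc_to_base_arc (x : X) : arc_to_base x (arc x).
Proof.
have [Bx|nBx] := pselect (base x); first by left; rewrite arc_base_point.
right; split => //; exists (p x) => //.
have gI : {in `[0, 1]%classic &, injective (g (p x))}.
  apply: (@hair_injective x (p x)); first by rewrite [RHS]foot_base.
  by move=> xp; apply: nBx; rewrite xp.
have [gc g0 _ _] := hairg (basep x).
have sx0 : 0 < s x.
  rewrite lt_neqAle; have /andP[-> _] := s01 x; rewrite andbT eq_sym.
  by apply/eqP => sx; apply: nBx; rewrite -(gps x) sx g0.
pose r (t : R) := s x * (1 - t).
have rI t : 0 <= t <= 1 -> 0 <= r t <= s x.
  move=> /andP[t0 t1]; rewrite /r mulr_ge0 ?subr_ge0// ?(ltW sx0)//=.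
  by rewrite ger_pMr// lerBlDr lerDl.
have arcE : arc x = (g (p x) \o r) @` `[0, 1]%classic.
  apply/seteqP; split => [_ [t /= t01 <-]|_ [t /= t01 <-]].
    exists (1 - t / s x) => /=.
      move: t01; rewrite !in_itv /= => /andP[t0 ts].
      by rewrite subr_ge0 lerBlDr lerDl divr_ge0 ?(ltW sx0)// ler_pdivrMr// mul1r ts.
    by rewrite /r opprB addrC subrK mulrC divfK// gt_eqF.
  by exists (r t) => //=; move: t01; rewrite !in_itv /=; exact: rI.
exists (g (p x) \o r); last first.
  by split => /=; rewrite /r ?subr0 ?subrr ?mulr1 ?mulr0.
rewrite arcE; apply: (compact_injective_homeomorphism_on 0).
- exact: metric_hausdorff.
- exact: segment_compact.
- apply/subspace_continuousP => t /=; rewrite in_itv /= => t01.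
  have rc : r @ within `[0, 1]%classic (nbhs t) -->
      within `[0, 1]%classic (nbhs (r t)).
    have rct : r @ nbhs t --> nbhs (r t).
      by apply: cvgM; [exact: cvg_cst|apply: cvgB; [exact: cvg_cst|exact: cvg_id]].
    move=> V /= nV.
    have : \forall u \near t, `[0, 1]%classic (r u) -> V (r u) := rct _ nV.
    apply: (@filterS _ (nbhs t)) => u /= Vr; rewrite in_itv /= => /rI u01; apply: Vr.
    by rewrite in_itv /=; have := sub_unit (x := x); move=> /(_ (r u)) /=;
      rewrite !in_itv /=; apply.
  have rt01 : (`[0, 1]%classic : set R) (r t).
    by apply: (sub_unit (x := x)); rewrite /= in_itv /=; exact: rI.
  by apply: (cvg_comp _ _ rc); exact: ((subspace_continuousP _ _).1 gc).
- move=> t u; rewrite !inE /= !in_itv /= => /rI rt /rI ru.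
  have sub v : 0 <= v <= s x -> v \in (`[0, 1]%classic : set R).
    by move=> v01; rewrite inE; apply: (sub_unit (x := x)); rewrite /= in_itv.
  move=> /(gI _ _ (sub _ rt) (sub _ ru)) /(mulfI (lt0r_neq0 sx0)).
  by move=> /addrI/oppr_inj.
Qed.

(** [axiom_A4] speaks of sequences: if the arcs of points near [x] were not close
    to that of [x], a sequence of counterexamples converging to [x] would violate it. *)
Lemma arc_hausdorff_near (x : X) (e : R) : 0 < e ->
  \forall y \near x, hausdorff_close (arc y) (arc x) e.
Proof.
move=> e0; apply: contrapT => nclose.
have /choice[y yP] : forall n : nat, exists y,
    ball x n.+1%:R^-1 y /\ ~ hausdorff_close (arc y) (arc x) e.
  move=> n; apply: contrapT => none; apply: nclose.
  apply: (filterS _ (nbhsx_ballx x n.+1%:R^-1 _)) => [y xy|]; last first.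
    by rewrite invr_gt0.
  by apply: contrapT => ny; apply: none; exists y.
have yx : y n @[n --> \oo] --> x.
  apply/metricType_numDomainType.cvgrPdist_lt => d d0.
  have [N _ NP] := near_infty_natSinv_lt (PosNum d0).
  exists N => // n /NP nd; have [+ _] := yP n; rewrite ballEmdist /= => xy.
  exact: lt_trans nd.
have := A4 yx (fun n => arc_to_base_arc (y n)) (arc_to_base_arc x).
move=> /(_ [set u | (u < e%:E)%E]); case.
  by apply: open_nbhs_nbhs; split; [exact: open_ereal_lt_ereal|rewrite /= lte_fin].
move=> N _ /(_ N (leqnn N)) /ereal_inf_lt[_ [d [d0 dA dA'] <-]].
rewrite lte_fin => de; have [_] := yP N; apply; split => //.
  by move=> a /dA[b Ab ba]; exists b => //; exact: le_ball (ltW de) _ ba.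
by move=> a /dA'[b Ab ba]; exists b => //; exact: le_ball (ltW de) _ ba.
Qed.

(** The part [Z] of the base outside a neighborhood of [p x] is compact and
    disjoint from the arc of [x], hence at positive distance [e] from it; the
    feet of points whose arcs are [e]-close to that of [x] avoid [Z]. *)
Lemma foot_continuous : continuous p.
Proof.
move=> x U nU; pose Z := base `&` ~` interior U.
have cZ : compact Z.
  apply: (subclosed_compact _ cptX) => //; apply: closedI; first exact: closed_closure.
  by apply: open_closedC; exact: open_interior.
have arcZ z : Z z -> ~ arc x z.
  by move=> [Bz nUz] /(arc_base Bz) zp; apply: nUz; rewrite zp.
have carc : closed (arc x).
  by apply: compact_closed; [exact: metric_hausdorff|exact: arc_compact].
have [e [/= e0 eZ]] : exists e : R, 0 < e /\
    forall z, Z z -> forall k, arc x k -> ~ ball z e k.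
  have [z Zz|d /= d0 dZ] := (compact_near_coveringP Z).1 cZ R 0^'+
    (fun e z => forall k, arc x k -> ~ ball z e k) _.
    have : nbhs z (~` arc x).
      by apply: open_nbhs_nbhs; split; [exact: closed_openC|exact: arcZ].
    move=> /nbhs_ballP[d /= d0 dz]; have d20 : 0 < d / 2 by rewrite divr_gt0.
    exists (ball z (d / 2), [set e | e < d / 2]) => /=.
      by split; [exact: nbhsx_ballx|exact: nbhs_right_lt].
    move=> [z' e] /= [zz' ed] k Ak z'k; apply: (dz k) => //.
    rewrite [d]splitr; apply: (ball_triangle zz').
    exact: le_ball (ltW ed) _ z'k.
  exists (d / 2); split; first by rewrite divr_gt0.
  move=> z Zz; apply: (dZ (d / 2)) => //=; last by rewrite divr_gt0.
  by rewrite sub0r normrN gtr0_norm ?divr_gt0// ltr_pdivrMr// ltr_pMr// ltr1n.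
have := @arc_hausdorff_near x e e0; apply: filterS => y [_ sub _] /=.
have [k Ak kp] := sub _ (arc_foot y).
apply: interior_subset; apply: contrapT => nU'.
by apply: (eZ (p y) _ k Ak); [split|exact: ball_sym].
Qed.

(** * The height of a point on its hair *)

Variable q : nat -> X.
Hypothesis q_dense : forall (x : X) (e : R), 0 < e -> exists n, mdist (q n) x < e.

Let weight (x : X) (n : nat) : R := mdist (q n) (p x) - set_dist (q n) (arc x).

(** A Whitney function of the arc from [x] to its foot, normalized to vanish on
    degenerate arcs: the distances to sets decrease as the arc grows. *)
Definition height (x : X) : R := weighted_sum (weight x).

Let weight_bounded : exists M, forall x n, 0 <= weight x n <= M.
Proof.
have [M HM] := compact_mdist_bounded cptX; exists M => x n.
rewrite /weight subr_ge0 set_dist_le; last exact: arc_foot.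
rewrite lerBlDr (le_trans (HM _ _))// lerDl.
by apply: le_set_dist => [|a _]; [exists x; exact: arc_tip|exact: mdist_ge0].
Qed.

(** Each term is Lipschitz in the foot and in the arc for the Hausdorff distance,
    uniformly in [n], and the weights sum to 2. *)
Lemma height_continuous : continuous height.
Proof.
move=> x; apply/cvgrPdist_le => e e0; have [M wM] := weight_bounded.
pose d := e / 4; have d0 : 0 < d by rewrite divr_gt0.
have wclose y y' : hausdorff_close (arc y) (arc y') d ->
    mdist (p y') (p y) < d -> height y' <= height y + e.
  move=> yy' /ltW pp; rewrite (_ : e = (d + d) * 2); last by rewrite /d; lra.
  apply: (weighted_sum_le (wM y') (wM y)) => n.
  have := metric_triangle (q n) (p y) (p y'); rewrite (metric_sym (p y)).
  have := @set_dist_hausdorff _ _ (q n) (arc y) (arc y') d _ yy'.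
  have : arc y' !=set0 by exists y'; exact: arc_tip.
  by move=> ne /(_ ne); rewrite /weight; move: pp; lra.
have close_sym y y' : hausdorff_close (arc y) (arc y') d ->
    hausdorff_close (arc y') (arc y) d by case.
have pc : \forall y \near x, mdist (p x) (p y) < d.
  have nb : nbhs (p x) (ball (p x) d) by exact: nbhsx_ballx.
  have : \forall y \near x, ball (p x) d (p y) := foot_continuous nb.
  by apply: filterS => y /=; rewrite ballEmdist.
apply: filterS2 (@arc_hausdorff_near x d d0) pc => y hyx pxy.
have := wclose y x hyx pxy; have := wclose x y (close_sym _ _ hyx).
rewrite metric_sym => /(_ pxy) yx xy; rewrite ler_norml; apply/andP; split; lra.
Qed.

Lemma height_base (b : X) : base b -> height b = 0.
Proof.
move=> Bb; apply: weighted_sum0 => n; rewrite /weight arc_base_point// foot_base//.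
apply/eqP; rewrite subr_eq0 eq_le set_dist_le// andbT.
by apply: le_set_dist => [|_ ->]; first by exists b.
Qed.

(** If [y] lies further up than [x], a point [q k] close enough to [y] is nearer
    to the arc of [y] than to that of [x], so one term increases strictly. *)
Let height_lt (x y : X) : p x = p y -> x <> y -> s x <= s y ->
  height x < height y.
Proof.
move=> pxy xy sxy; have [M wM] := weight_bounded.
have arcxy : arc x `<=` arc y.
  move=> _ [t /= t01 <-]; exists t; last by rewrite pxy.
  by move: t01; rewrite /= !in_itv /= => /andP[-> /le_trans]; apply.
have gI := hair_injective pxy xy.
have nyx : ~ arc x y.
  move=> [t t01 gt]; have := sub_unit t01; move: t01; rewrite /= !in_itv /=.
  move=> /andP[_ ts] t01; apply: xy; rewrite -(gps x) -(gps y) -pxy.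
  have tsy : t = s y by apply: gI; rewrite ?inE /= ?in_itv//= gt pxy gps.
  by congr (g _ _); apply/eqP; rewrite eq_le sxy -tsy.
have carc : closed (arc x).
  by apply: compact_closed; [exact: metric_hausdorff|exact: arc_compact].
have : nbhs y (~` arc x) by apply: open_nbhs_nbhs; split => //; exact: closed_openC.
move=> /nbhs_ballP[d /= d0 dy].
have d20 : 0 < d / 2 by rewrite divr_gt0.
have [k qk] := q_dense y d20.
apply: (weighted_sum_lt (k := k) (wM x) (wM y)) => [n|]; rewrite /weight pxy.
  rewrite lerD2l lerN2; apply: le_set_dist; first by exists x; exact: arc_tip.
  by move=> a /arcxy; exact: set_dist_le.
rewrite ltrD2l ltrN2; apply: (@lt_le_trans _ _ (d / 2)).
  by apply: le_lt_trans qk; apply: set_dist_le; exact: arc_tip.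
apply: le_set_dist; first by exists x; exact: arc_tip.
move=> a Aa; rewrite leNgt; apply/negP => qa; apply: (dy a) => //.
rewrite ballEmdist /= [d]splitr; apply: le_lt_trans (metric_triangle _ (q k) _) _.
by rewrite ltrD// metric_sym.
Qed.

Lemma height_injective (x y : X) : p x = p y -> height x = height y -> x = y.
Proof.
move=> pxy hxy; apply: contrapT => xy.
have [sxy|/ltW syx] := leP (s x) (s y).
  by have := height_lt pxy xy sxy; rewrite hxy ltxx.
by have := height_lt (esym pxy) (nesym xy) syx; rewrite hxy ltxx.
Qed.

Lemma height_ge0 (x : X) : 0 <= height x.
Proof.
have [M wM] := weight_bounded.
have := @weighted_sum_le _ (fun=> 0) (weight x) M 0 _ (wM x).
rewrite mul0r addr0 weighted_sum0//; apply => n; have /andP[w0 wM'] := wM x n.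
  by rewrite lexx (le_trans w0).
by rewrite addr0.
Qed.

Lemma height_intermediate (x : X) (t : R) : 0 <= t -> t <= height x ->
  exists y, p y = p x /\ height y = t.
Proof.
move=> t0 tx; have cc : connected (height @` comp x).
  apply: connected_continuous_connected; first exact: component_connected.
  by apply: continuous_subspaceT; exact: height_continuous.
have /(_ 0 (height x)) := (connected_intervalP _).1 cc.
have [] : (height @` comp x) 0 /\ (height @` comp x) (height x).
  split; last by exists x => //; exact: mem_component.
  exists (p x); last exact: height_base.
  by apply: foot_comp; rewrite [RHS]foot_base.
move=> H0 Hx /(_ H0 Hx t); rewrite t0 tx => /(_ isT)[y xy <-].
by exists y; split => //; apply/esym; exact: foot_eq.
Qed.

(** Along a homeomorphism from [[0, 1]] onto the hair that starts at [e], the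
    height is continuous and injective, hence monotone.  If it increases then
    [e] is lowest and is the foot; if it decreases then [e] is highest.  The
    other end of the arc has a different height, so one of them is positive. *)
Lemma end_point_extremal (K : set X) (e : X) : arc_component K ->
  arc_end_point K e ->
  [/\ base e \/ forall y, p y = p e -> height y <= height e &
      exists2 y, p y = p e & 0 < height y].
Proof.
move=> [[x KE] _] [y [f [[ff fI fs] fc _] [f0 f1]]].
have I0 : (`[0, 1]%classic : set R) 0 by rewrite /= in_itv /= lexx ler01.
have I1 : (`[0, 1]%classic : set R) 1 by rewrite /= in_itv /= lexx ler01.
have Kp z : K z -> p z = p e.
  rewrite KE => xz; apply/esym; rewrite -(foot_eq xz); apply/esym/foot_eq.
  by rewrite -KE -f0; exact: ff.
have pK z : p z = p e -> K z.
  move=> ze; rewrite KE; apply: (@connected_component_trans _ _ e).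
    by rewrite -KE -f0; exact: ff.
  exact: foot_comp.
have hfc : {within `[0, 1]%classic, continuous (height \o f)}.
  apply/subspace_continuousP => t It.
  have ft : f @ within `[0, 1]%classic (nbhs t) --> f t.
    exact: ((subspace_continuousP _ _).1 fc).
  exact: (cvg_comp _ _ ft (@height_continuous (f t))).
have hfI : {in `[0, 1] &, injective (height \o f)}.
  move=> t u It Iu /= /height_injective ftu.
  apply: fI; rewrite ?inE //; apply: ftu.
  by rewrite (Kp (f t)) ?(Kp (f u))//; exact: ff.
split; last first.
  have [h0|h0] := leP (height e) 0; last by exists e.
  exists y; first by apply: Kp; rewrite -f1; exact: ff.
  have he : height e = 0 by apply/eqP; rewrite eq_le h0 height_ge0.
  rewrite lt_neqAle height_ge0 andbT -he; apply/negP => /eqP hey.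
  have : (0 : R) = 1.
    by apply: hfI; rewrite ?in_itv /= ?lexx ?ler01// f0 f1.
  by move=> /esym/eqP; rewrite oner_eq0.
have [inc|dec] := itv_continuous_inj_mono hfc hfI.
  left; have [t0 It0 ft0] : exists2 t, (`[0, 1]%classic : set R) t & f t = p e.
    by have [|t It ft] := fs (p e); [apply: pK; rewrite foot_base|exists t].
  have e0 : height e = 0.
    apply/eqP; rewrite eq_le height_ge0 andbT -(height_base (basep e)) -ft0 -f0.
    have [->//|t00] := eqVneq t0 0; apply/ltW/inc => //.
    by rewrite lt_neqAle eq_sym t00; move: It0; rewrite /= in_itv /= => /andP[].
  have -> : e = p e; last exact: basep.
  by apply: height_injective; [rewrite [RHS]foot_base|rewrite e0 height_base].
right => z /pK /fs[t It <-]; rewrite -f0.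
have [->//|t00] := eqVneq t 0; apply/ltW/dec => //.
by rewrite lt_neqAle eq_sym t00; move: It; rewrite /= in_itv /= => /andP[].
Qed.

End HairSystem.

(** * From coordinates on the space to a straight hairy Cantor set *)

Section Coordinates.
Context {R : realType} {X : topologicalType}.
(** [k] is the foot, transported to the Cantor space, and [f] the height. *)
Variables (k : X -> cantor_space) (f : X -> R).
Hypothesis cptX : compact [set: X].
Hypothesis kc : continuous k.
Hypothesis fc : continuous f.
Hypothesis kfI : forall x y, k x = k y -> f x = f y -> x = y.
Hypothesis f0 : forall x, 0 <= f x.
Hypothesis k_surj : forall a, exists x, k x = a.
Hypothesis f_down : forall x t, 0 <= t -> t <= f x ->
  exists y, k y = k x /\ f y = t.
Hypothesis tips_dense : forall W : set X, open W -> W !=set0 ->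
  exists2 e, W e & (f e = 0 \/ forall y, k y = k e -> f y <= f e) /\
    exists2 y, k y = k e & 0 < f y.

(** The height function [l] is the maximum of [f] on the fibers of [k].  It is
    upper semicontinuous because the points of height at least [c] form a
    compact set.  A point of height strictly between [u] and [v] on the hair
    over [a] is a limit of end points of arcs, which have positive height and
    hence are tips; their feet are the points asked for by [intermediate]. *)
Lemma straight_hairy_of_coordinates :
  exists2 H : set (R * R), straight_hairy_cantor_set H &
    homeomorphic [set: X] H.
Proof.
have /choice[top topP] : forall a, exists x,
    k x = a /\ forall y, k y = a -> f y <= f x.
  move=> a; have fib0 : k @^-1` [set a] !=set0.
    by have [x xa] := k_surj a; exists x.
  have cfib : compact (k @^-1` [set a]).
    apply: (subclosed_compact _ cptX) => //.
    apply: (continuous_closedP k).1 => //.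
    by apply: compact_closed; [exact: cantor_space_hausdorff|exact: compact_set1].
  have [x xa xmax] :=
    compact_EVT_max fib0 cfib (continuous_subspaceT (f := f) fc).
  by exists x; split => [|y ya]; [rewrite inE in xa|apply: xmax; rewrite inE].
pose l a := f (top a).
have l_ge x : f x <= l (k x) by exact: (topP (k x)).2.
have k_top a : k (top a) = a by exact: (topP a).1.
have usc (a : cantor_space) c : l a < c -> \forall b \near a, l b < c.
  move=> lac; pose Z := f @^-1` [set t | c <= t].
  have cZ : closed (k @` Z).
    apply: compact_closed; first exact: cantor_space_hausdorff.
    apply: continuous_compact; first exact: continuous_subspaceT.
    apply: (subclosed_compact _ cptX) => //.
    by apply: (continuous_closedP f).1 => //; exact: closed_ge.
  have : nbhs a (~` (k @` Z)).
    apply: open_nbhs_nbhs; split; first exact: closed_openC.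
    move=> [x cx xa]; have := l_ge x; rewrite xa.
    by move=> /(le_trans cx); rewrite leNgt lac.
  apply: filterS => b nb; rewrite ltNge; apply/negP => cb; apply: nb.
  by exists (top b).
have pos_dense (a : cantor_space) (U : set cantor_space) : nbhs a U ->
    exists2 b, U b & 0 < l b.
  rewrite nbhsE => -[V [oV Va] VU].
  have [||e Ve [_ [y ye fy]]] := tips_dense (W := k @^-1` V).
  - by apply: (continuousP k).1.
  - by exists (top a); rewrite /= k_top.
  - by exists (k e); [exact: VU|rewrite -ye (lt_le_trans fy)].
have intermediate (a : cantor_space) (U : set cantor_space) (u v : R) :
    nbhs a U -> 0 <= u -> u < v -> v <= l a ->
    exists p, [/\ U p, u < l p & l p < v].
  rewrite nbhsE => -[V [oV Va] VU] u0 uv va.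
  have [||e [Ve /= fe] [etip _]] :=
    tips_dense (W := k @^-1` V `&` f @^-1` `]u, v[%classic).
  - apply: openI; first by apply: (continuousP k).1.
    by apply: (continuousP f).1 => //; exact: interval_open.
  - have [||x [xa fx]] := @f_down (top a) ((u + v) / 2).
    + by rewrite divr_ge0// addr_ge0// (le_trans u0)// ltW.
    + by rewrite (le_trans _ va)// ler_pdivrMr//; lra.
    + exists x; split; first by rewrite /= xa k_top.
      by rewrite /= fx in_itv /=; apply/andP; split; lra.
  move: fe; rewrite in_itv /= => /andP[ue ev].
  have le : l (k e) = f e.
    case: etip => [e0|emax]; first by exfalso; lra.
    by apply/eqP; rewrite eq_le l_ge emax.
  by exists (k e); rewrite le; split => //; exact: VU.
have bounded : exists M, forall a, l a <= M.
  have X0 : [set: X] !=set0 by have [x _] := k_surj point; exists x.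
  have [x _ xmax] := compact_EVT_max X0 cptX (continuous_subspaceT (f := f) fc).
  by exists (f x) => a; apply: xmax; rewrite inE.
have [h [hc hI straight]] := straight_embedding (fun a => f0 (top a)) bounded usc
  pos_dense intermediate.
exists [set p : R * R | exists2 a, p.1 = h a & 0 <= p.2 <= l a] => //.
pose F x := (h (k x), f x).
have -> : [set p : R * R | exists2 a, p.1 = h a & 0 <= p.2 <= l a] = range F.
  apply/seteqP; split=> [[u t] [a /= -> /andP[t0 ta]]|_ [x _ <-]].
    have [x [xa <-]] := f_down t0 ta; exists x => //.
    by rewrite /F xa k_top.
  by exists (k x); rewrite //= f0 l_ge.
have [x0 _] := k_surj point.
exists F; apply: (compact_injective_homeomorphism_on x0) => //.
- apply: continuous_subspaceT => x.
  have hk : h (k y) @[y --> x] --> h (k x).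
    exact: (cvg_comp _ _ (@kc x) (@hc (k x))).
  exact: (cvg_pair hk (@fc x)).
- by move=> x y _ _ [/hI kxy fxy]; exact: kfI.
Qed.

End Coordinates.

Theorem theorem1p3 (R : realType) (X : metricType R)
    (cptX : compact [set: X])
    (A1 : axiom_A1 X) (A2 : axiom_A2 X) (A3 : axiom_A3 X) (A4 : axiom_A4 X)
    (A6' : axiom_A6' X) :
  exists2 H : set (R * R), straight_hairy_cantor_set H &
    homeomorphic [set: X] H.
Proof.
have [c [cbij cc [d dc cd]]] := A2; have [cB cI cS] := cbij.
have [g [p [s sys]]] := hair_system_exists A1 A3.
have basep : forall x : X, hairy_base (p x) by case: sys.
have [q q_dense] := compact_dense_sequence (c point) cptX.
pose f := height g p s q; pose k x : cantor_space := d (p x).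
have pc : continuous p := foot_continuous cptX A1 A3 A4 sys.
have ck x : c (k x) = p x.
  have [a _ ap] := cS _ (basep x); rewrite /k -ap.
  by rewrite cd// inE.
have kp x y : k x = k y <-> p x = p y.
  by split => [kxy|pxy]; [rewrite -!ck kxy|rewrite /k pxy].
have pb := foot_base A1 A3 sys.
have f_cont := height_continuous cptX A1 A3 A4 sys (q := q).
have f_base := height_base A1 A3 sys q.
have f_inj := height_injective cptX sys q_dense.
have f_down := height_intermediate cptX A1 A3 A4 sys (q := q).
apply: (@straight_hairy_of_coordinates R X k f) => //.
- move=> x; have px : p @ nbhs x --> within (hairy_base (X:=X)) (nbhs (p x)).
    move=> V nV.
    have : \forall y \near x, hairy_base (p y) -> V (p y) := pc x _ nV.
    by apply: (@filterS _ (nbhs x)) => y; apply; exact: basep.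
  have dp : d @ within (hairy_base (X:=X)) (nbhs (p x)) --> d (p x).
    exact: ((subspace_continuousP _ _).1 dc).
  exact: (cvg_comp _ _ px dp).
- by move=> x y /kp; exact: f_inj.
- move=> x; exact: (height_ge0 cptX sys).
- move=> a; exists (c a); rewrite /k pb; last exact: cB.
  by apply: cd; rewrite inE.
- move=> x t t0 tx; have [y [yx yt]] := f_down x t t0 tx.
  by exists y; split => //; exact/kp.
- move=> W oW W0; have [e [We [K aK eK]]] := A6' W W0 oW.
  have [tip [y ye fy]] := end_point_extremal cptX A1 A3 A4 sys q_dense aK eK.
  exists e => //; split; last by exists y => //; exact/kp.
  by case: tip => [/f_base|emax]; [left|right => z /kp; exact: emax].
Qed.
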